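(* Let $H_1, H_2$ be complex Hilbert spaces and let $X \in B(H_2, H_1)$, $Y \in B(H_1, H_2)$. Then \[ w^4\begin{pmatrix} 0 & X \\ Y & 0 \end{pmatrix} \geq \frac{1}{16}\|S\|^2+\frac{1}{4}c^2(YX)+\frac{1}{8}m(YXS+SYX), \] where $S=|X|^2+|Y^{*}|^2 \in B(H_2)$ and $c(YX)=\inf_{\theta \in \mathbb{R}}\ \inf_{x\in H_2,\ \|x\|=1}\|\mathrm{Re}(e^{i\theta}YX)x\|$.
   Context: $B(H_1,H_2)$ denotes the set of all bounded linear operators from the complex Hilbert space $H_1$ to the complex Hilbert space $H_2$, and $B(H)=B(H,H)$. For an operator $T$, $\|T\|$ is the operator norm and $|T|^2=T^{*}T$ (so $|X|^2=X^*X$ and $|Y^*|^2=YY^*$). For $T\in B(H)$: $\mathrm{Re}(T)=\frac12(T+T^* )$; the numerical radius is $w(T)=\sup\{|\langle Tx,x\rangle| : x\in H,\ \|x\|=1\}$; the Crawford number is $m(T)=\inf\{|\langle Tx,x\rangle| : x\in H,\ \|x\|=1\}$. Powers such as $w^4(T)$, $c^2(T)$ mean $(w(T))^4$, $(c(T))^2$. The operator matrix $\begin{pmatrix} 0 & X \\ Y & 0\end{pmatrix}$ acts on the Hilbert space direct sum $H_1\oplus H_2$ by $(x_1,x_2)\mapsto (Xx_2, Yx_1)$. *)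

(* Defs.v *)
From HB Require Import structures.
From mathcomp Require Import all_boot all_order all_algebra sesquilinear.
From mathcomp Require Import complex ring lra.
From mathcomp Require Import boolp classical_sets functions reals topology.
From mathcomp Require Import normedtype trigo.

Set Implicit Arguments.
Unset Strict Implicit.
Unset Printing Implicit Defensive.

Import Order.TTheory GRing.Theory Num.Theory.
Import numFieldNormedType.Exports.

Local Open Scope classical_set_scope.
Local Open Scope ring_scope.
Local Open Scope complex_scope.

(* The form is linear in the first argument, conjugate-linear in the second. *)
HB.mixin Record CompleteNormedModule_isHilbert (R : realType) H
    & CompleteNormedModule R[i] H := {
  inner : {dot H for (@Num.conj R[i])} ;
  inner_norm : forall x : H, inner x x = `|x| ^+ 2 }.

#[short(type="hilbertType")]
HB.structure Definition Hilbert (R : realType) :=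
  {H of CompleteNormedModule R[i] H & CompleteNormedModule_isHilbert R H}.

Notation "''[' x , y ]" := (inner x y) (format "''[' x ,  y ]") : ring_scope.

(* An alias of the product, whose library instance carries the max norm: the
   direct sum has its own norm, with square `|x.1| ^+ 2 + `|x.2| ^+ 2. *)
Definition hsum (R : realType) (H1 H2 : hilbertType R) : Type := (H1 * H2)%type.

Section hsum.
Variables (R : realType) (H1 H2 : hilbertType R).
Local Notation C := R[i].
Local Notation E := (hsum H1 H2).

HB.instance Definition _ := GRing.Lmodule.copy E (H1 * H2)%type.

Definition hsum_norm (x : E) : C := sqrtC (`|x.1| ^+ 2 + `|x.2| ^+ 2).

Let nn (x : E) : 0 <= `|x.1| ^+ 2 + `|x.2| ^+ 2.
Proof. by rewrite addr_ge0// exprn_ge0. Qed.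

Fact hsum_normD (x y : E) : hsum_norm (x + y) <= hsum_norm x + hsum_norm y.
Proof.
have rl (z : E) : hsum_norm z ^+ 2 = `|z.1| ^+ 2 + `|z.2| ^+ 2.
  by rewrite sqrtCK.
have n0 (z : E) : 0 <= hsum_norm z by rewrite sqrtC_ge0.
rewrite -ler_sqr ?nnegrE ?addr_ge0// sqrrD !rl/=.
have le1 : `|x.1 + y.1| ^+ 2 <= (`|x.1| + `|y.1|) ^+ 2.
  by rewrite ler_sqr ?nnegrE ?addr_ge0 ?ler_normD.
have le2 : `|x.2 + y.2| ^+ 2 <= (`|x.2| + `|y.2|) ^+ 2.
  by rewrite ler_sqr ?nnegrE ?addr_ge0 ?ler_normD.
apply: (le_trans (lerD le1 le2)); rewrite !sqrrD.
rewrite [leLHS](_ : _ = `|x.1| ^+ 2 + `|x.2| ^+ 2 +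
  (`|x.1| * `|y.1| + `|x.2| * `|y.2|) *+ 2 + (`|y.1| ^+ 2 + `|y.2| ^+ 2)); last first.
  by rewrite mulrnDl; rewrite addrACA (addrACA (`|x.1| ^+ 2)).
rewrite lerD2r lerD2l lerMn2r /=.
rewrite -ler_sqr ?nnegrE ?addr_ge0 ?mulr_ge0// exprMn !rl -subr_ge0.
have -> : (`|x.1| ^+ 2 + `|x.2| ^+ 2) * (`|y.1| ^+ 2 + `|y.2| ^+ 2)
    - (`|x.1| * `|y.1| + `|x.2| * `|y.2|) ^+ 2
    = (`|x.1| * `|y.2| - `|x.2| * `|y.1|) ^+ 2 by ring.
by rewrite real_exprn_even_ge0// realB// ger0_real// mulr_ge0.
Qed.

Fact hsum_normZ (l : C) (x : E) : hsum_norm (l *: x) = `|l| * hsum_norm x.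
Proof.
rewrite /hsum_norm /= !normrZ !exprMn -mulrDr.
by rewrite rootCMl ?exprn_ge0// sqrCK.
Qed.

Fact hsum_norm0_eq0 (x : E) : hsum_norm x = 0 -> x = 0.
Proof.
move=> /eqP; rewrite sqrtC_eq0 paddr_eq0 ?exprn_ge0// !sqrf_eq0 !normr_eq0.
by case: x => x1 x2 /= /andP[/eqP-> /eqP->].
Qed.

HB.instance Definition _ :=
  Lmodule_isNormed.Build C E hsum_normD hsum_normZ hsum_norm0_eq0.

Let normE (x : E) : `|x| = sqrtC (`|x.1| ^+ 2 + `|x.2| ^+ 2).
Proof. by []. Qed.

Let norm1 (x : E) : `|x.1| <= `|x|.
Proof.
by rewrite normE -ler_sqr ?nnegrE ?sqrtC_ge0// sqrtCK lerDl exprn_ge0.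
Qed.

Let norm2 (x : E) : `|x.2| <= `|x|.
Proof.
by rewrite normE -ler_sqr ?nnegrE ?sqrtC_ge0// sqrtCK lerDr exprn_ge0.
Qed.

Let norm_le (x : E) : `|x| <= `|x.1| + `|x.2|.
Proof.
rewrite normE -ler_sqr ?nnegrE ?sqrtC_ge0// ?addr_ge0// sqrtCK sqrrD.
by rewrite lerD2r lerDl mulrn_wge0// mulr_ge0.
Qed.

Fact hsum_complete (F : set_system E) : ProperFilter F -> cauchy F -> cvg F.
Proof.
move=> FF /cauchyP Fc.
have c1 : cauchy ((fun x : E => x.1) @ F).
  apply/cauchyP => e e0; have [x Fx] := Fc e e0.
  exists x.1; change (F [set y : E | ball x.1 e y.1]).
  apply: filterS Fx => y; rewrite -!ball_normE /=.
  by apply: le_lt_trans; exact: (norm1 (x - y)).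
have c2 : cauchy ((fun x : E => x.2) @ F).
  apply/cauchyP => e e0; have [x Fx] := Fc e e0.
  exists x.2; change (F [set y : E | ball x.2 e y.2]).
  apply: filterS Fx => y; rewrite -!ball_normE /=.
  by apply: le_lt_trans; exact: (norm2 (x - y)).
have [l1 /cvgrPdist_lt l1P] : exists l : H1, (fun x : E => x.1) @ F --> l.
  by apply/cvg_ex; exact: cauchy_cvg.
have [l2 /cvgrPdist_lt l2P] : exists l : H2, (fun x : E => x.2) @ F --> l.
  by apply/cvg_ex; exact: cauchy_cvg.
apply/cvg_ex; exists ((l1, l2) : E); apply/fcvgrPdist_lt => e e0.
have e20 : 0 < e / 2 by rewrite divr_gt0.
near=> x; rewrite (le_lt_trans (norm_le _))// (splitr e) ltrD//=.
- by near: x; exact: l1P.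
- by near: x; exact: l2P.
Unshelve. all: by end_near. Qed.

HB.instance Definition _ := Uniform_isComplete.Build E hsum_complete.

Definition hsum_inner (x y : E) : C := '[x.1, y.1] + '[x.2, y.2].

Fact hsum_inner_bilinear : bilinear_for
  ( *%R : GRing.Scale.law C C) (Num.conj \; *%R : GRing.Scale.law C C)
  hsum_inner.
Proof.
rewrite /hsum_inner; split=> [y a u v|x a u v] /=.
  by rewrite !linearPl !mulrDr addrACA.
by rewrite !linearPr /= mulrDr addrACA.
Qed.

HB.instance Definition _ :=
  bilinear_isBilinear.Build C E E C _ _ hsum_inner hsum_inner_bilinear.

Fact hsum_inner_herm (x y : E) :
  hsum_inner x y = (-1) ^+ false * Num.conj (hsum_inner y x).
Proof.
rewrite /hsum_inner (hermC inner x.1) (hermC inner x.2).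
by rewrite !expr0 !mul1r rmorphD.
Qed.

HB.instance Definition _ :=
  isHermitianSesquilinear.Build C E false Num.conj hsum_inner hsum_inner_herm.

Fact hsum_inner_gt0 (x : E) : x != 0 -> 0 < hsum_inner x x.
Proof.
by move=> x0; rewrite /hsum_inner !inner_norm -[ltRHS]sqrtCK -normE exprn_gt0 ?normr_gt0.
Qed.
HB.instance Definition _ := isDotProduct.Build C E hsum_inner hsum_inner_gt0.

Fact hsum_inner_norm (x : E) : hsum_inner x x = `|x| ^+ 2.
Proof. by rewrite /hsum_inner !inner_norm normE sqrtCK. Qed.

HB.instance Definition _ := CompleteNormedModule_isHilbert.Build R E hsum_inner_norm.
End hsum.

Lemma discr (R : realType) (a c e : R) : 0 <= a ->
  (forall t, 0 <= t ^+ 2 * a + t * c *+ 2 + e) -> c ^+ 2 <= e * a.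
Proof.
move=> a0 h; have [a_gt0|] := ltP 0 a; last first.
  move=> a_le0; have {a_le0 a0} a0 : a = 0 by apply/eqP; rewrite eq_le a_le0.
  have [->|c0] := eqVneq c 0; first by rewrite a0 mulr0 expr0n.
  have := h (- (e + 1) / (c *+ 2)); rewrite a0 mulr0 add0r -mulrnAr.
  by rewrite divfK ?mulrn_eq0//; lra.
have := h (- c / a).
have -> : (- c / a) ^+ 2 * a + - c / a * c *+ 2 + e = (e * a - c ^+ 2) / a.
  by field; rewrite gt_eqF.
by rewrite pmulr_lge0 ?invr_gt0// subr_ge0.
Qed.

Section riesz.
Variables (R : realType) (H : hilbertType R).
Local Notation C := R[i].
Implicit Types x y z v : H.

Let B x y : R := complex.Re '[x, y].
Let q x : R := B x x.

Let innerDl x y z : '[x + y, z] = '[x, z] + '[y, z].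
Proof. by rewrite linearDl. Qed.
Let innerDr x y z : '[x, y + z] = '[x, y] + '[x, z].
Proof. by rewrite linearDr. Qed.
Let innerZl (a : C) x y : '[a *: x, y] = a * '[x, y].
Proof. by rewrite linearZl_LR. Qed.
Let innerC x y : '[x, y] = Num.conj '[y, x].
Proof. by rewrite (hermC inner) expr0 mul1r. Qed.

Let BC x y : B x y = B y x.
Proof. rewrite /B innerC. by case: '[y, x]. Qed.
Let BDl x y z : B (x + y) z = B x z + B y z.
Proof. rewrite /B innerDl. by case: '[x, z] => ??; case: '[y, z] => ??. Qed.
Let BDr x y z : B x (y + z) = B x y + B x z.
Proof. by rewrite BC BDl !(BC x). Qed.
Let BZl (t : R) x y : B (t%:C *: x) y = t * B x y.
Proof. by rewrite /B innerZl; case: '[x, y] => a b /=; rewrite mul0r subr0. Qed.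
Let BZr (t : R) x y : B x (t%:C *: y) = t * B x y.
Proof. by rewrite BC BZl BC. Qed.

Let qE x : (q x)%:C = `|x| ^+ 2.
Proof.
rewrite -inner_norm /q /B RRe_real// inner_norm ger0_real// exprn_ge0//.
Qed.
Let q_ge0 x : 0 <= q x.
Proof. by rewrite -lecR qE exprn_ge0. Qed.

Lemma CS_re x v : B x v ^+ 2 <= q x * q v.
Proof.
apply: discr => // t; have := q_ge0 (x + t%:C *: v).
rewrite /q !BDl !BDr !BZl !BZr (BC v x); set a := B x x; set b := B x v.
set c := B v v; nra.
Qed.

Let ball_q x (e : R) : 0 < e -> forall y, q (x - y) < e ^+ 2 -> `|x - y| < e%:C.
Proof.
move=> e0 y; rewrite -ltcR qE rmorphXn /= ltr_sqr; [by []|exact: normr_ge0|by rewrite nnegrE lecR ltW].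
Qed.

Variables (f : H -> C) (K : R).
Hypothesis K0 : 0 <= K.
Hypothesis fD : forall x y, f (x + y) = f x + f y.
Hypothesis fZ : forall a x, f (a *: x) = a * f x.
Hypothesis fK : forall x, complex.Re (f x) ^+ 2 <= K * q x.

Let g x := complex.Re (f x).
Let gD x y : g (x + y) = g x + g y.
Proof. rewrite /g fD. by case: (f x) => ??; case: (f y) => ??. Qed.
Let gZ (t : R) x : g (t%:C *: x) = t * g x.
Proof. by rewrite /g fZ; case: (f x) => a b /=; rewrite mul0r subr0. Qed.

Let phi x := q x - g x *+ 2.
Let phi_lb x : - K <= phi x.
Proof.
rewrite /phi; have := fK x; rewrite -/(g x); have := q_ge0 x.
set a := q x; set b := g x => a0 h; rewrite leNgt; apply/negP => lt.
have l1 : 0 < b *+ 2 - (a + K) by move: lt; lra.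
have l2 : 0 < b *+ 2 + (a + K) by move: l1 K0 a0; lra.
have := mulr_gt0 l1 l2; have := sqr_ge0 (a - K); move: h; nra.
Qed.

Let d := inf (range phi).
Let d_le x : d <= phi x.
Proof.
apply: ge_inf; last by exists x.
by exists (- K) => _ [y _ <-].
Qed.
Let dP (e : R) : 0 < e -> exists x, phi x < d + e.
Proof.
move=> e0; have [|_ [x _ <-] h] := @inf_adherent _ (range phi) e e0.
  split; first by exists (phi 0), 0.
  by exists (- K) => _ [y _ <-].
by exists x.
Qed.

Let close x y e : phi x < d + e -> phi y < d + e -> q (x - y) <= e *+ 4.
Proof.
move=> hx hy; have := d_le ((1/2)%:C *: (x + y)).
have -> : phi ((1/2)%:C *: (x + y)) = (phi x + phi y) / 2 - q (x - y) / 4.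
  have -> : x - y = x + (-1)%:C *: y by rewrite rmorphN rmorph1 scaleN1r.
  rewrite /phi /q gZ gD !(BDl, BDr, BZl, BZr) (BC y x).
  by field.
lra.
Qed.

Let F : set_system H := [set A | exists2 e : R, 0 < e & [set x | phi x < d + e] `<=` A].
Let FF : ProperFilter F.
Proof.
apply: Build_ProperFilter_ex.
  move=> A [e e0 eA]; have [x xe] := dP e0; exists x; exact: eA.
split; first by exists 1.
- move=> A A' [e e0 eA] [e' e'0 eA']; exists (Num.min e e').
    by rewrite lt_min e0.
  move=> x /= h; split; [apply: eA|apply: eA'] => /=;
  by apply: (lt_le_trans h); rewrite lerD2l ge_min lexx ?orbT.
- by move=> A A' AA' [e e0 eA]; exists e => // x /eA/AA'.
Qed.

Let Fcvg : exists z : H, F --> z.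
Proof.
suff Fc : cauchy_ex F.
  have cF : cauchy F := @cauchy_exP _ _ F FF Fc.
  by have /cvg_ex := @cauchy_cvg H F FF cF.
move=> e e0.
have er : e = (complex.Re e)%:C by rewrite RRe_real// gtr0_real.
have re0 : 0 < complex.Re e by rewrite -ltcR -er.
have e20 : 0 < complex.Re e ^+ 2 / 5 by rewrite divr_gt0 ?exprn_gt0.
have [x xe] := dP e20; exists x.
exists (complex.Re e ^+ 2 / 5) => // y /= ye.
rewrite -ball_normE /= er; apply: ball_q => //.
apply: (le_lt_trans (close xe ye)); move: e20; lra.
Qed.

Lemma riesz : exists z : H, forall x, f x = '[x, z].
Proof.
have [z Fz] := Fcvg; exists z.
have approx (e : R) : 0 < e -> exists x, phi x < d + e /\ q (z - x) < e.
  move=> e0; pose s := Num.sqrt e.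
  have s0 : 0 < s by rewrite sqrtr_gt0.
  have : F (ball z s%:C) by apply/Fz/nbhsx_ballx; rewrite ltcR.
  move=> [e' e'0 h]; have [|x xe] := @dP (Num.min e e').
    by rewrite lt_min e0.
  exists x; split; first by apply: (lt_le_trans xe); rewrite lerD2l ge_min lexx.
  have /h : phi x < d + e'.
    by apply: (lt_le_trans xe); rewrite lerD2l ge_min lexx orbT.
  rewrite -ball_normE /= => hx.
  rewrite -(sqr_sqrtr (ltW e0)) -ltcR qE rmorphXn /=.
  rewrite ltr_sqr; [exact: hx|exact: normr_ge0|by rewrite nnegrE lecR ltW].
have var x e v : phi x < d + e -> (B x v - g v) ^+ 2 <= e * q v.
  move=> xe; apply: discr => // t.
  have := d_le (x + t%:C *: v).
  have -> : phi (x + t%:C *: v) = phi x + (t ^+ 2 * q v + t * (B x v - g v) *+ 2).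
    by rewrite /phi /q gD gZ !(BDl, BDr, BZl, BZr) (BC v x); ring.
  by lra.
have gE v : g v = B v z.
  have : (B z v - g v) ^+ 2 <= 0.
    apply/ler_addgt0Pr => e e0; rewrite add0r.
    have e1 : 0 < e / 4 / (q v + 1) by rewrite !divr_gt0// ltr_wpDl.
    have [x [/(var _ _ v) h1 h2]] := approx _ e1.
    have h3 := CS_re (z - x) v.
    have -> : B z v - g v = (B x v - g v) + B (z - x) v.
      have {1}-> : z = x + (z - x) by rewrite addrCA subrr addr0.
      by rewrite BDl addrAC.
    have h4 : e / 4 / (q v + 1) * q v <= e / 4.
      by rewrite -mulrA ler_piMr ?divr_ge0 ?(ltW e0)// ler_pdivrMl ?ltr_wpDl// mulr1 lerDl.
    have h5 : q (z - x) * q v <= e / 4 / (q v + 1) * q v.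
      by rewrite ler_wpM2r// ltW.
    move: h1 h3 h4 h5; set a := B x v - g v; set b := B (z - x) v.
    have := sqr_ge0 (a - b); nra.
  by move=> h; apply/eqP; rewrite BC eq_sym -subr_eq0 -sqrf_eq0 eq_le h sqr_ge0.
move=> x; have h1 := gE x; have := gE ('i *: x).
move: h1; rewrite /g /B fZ innerZl.
case: (f x) => a b; case: '[x, z] => c e /= -> h.
by congr (_ +i* _); lra.
Qed.

End riesz.

(* The norm of a space over R[i] is itself a (nonnegative real) element of
   R[i]; rnorm is the same number in R, as needed for sup and inf. *)
Definition rnorm (R : realType) (V : normedZmodType R[i]) (x : V) : R :=
  complex.Re `|x|.

Definition expi (R : realType) (t : R) : R[i] := cos t +i* sin t.

(* Well-defined on bounded linear operators, see adjointP. *)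
Definition adjoint (R : realType) (H1 H2 : hilbertType R) (T : H1 -> H2) :
    H2 -> H1 :=
  xget (fun=> 0) [set S | forall x y, '[T x, y] = '[x, S y]].

Lemma adjointP (R : realType) (H1 H2 : hilbertType R) (T : {linear H1 -> H2}) :
  bounded_near T (nbhs 0) ->
  forall x y, '[T x, y] = '[x, adjoint T y].
Proof.
move=> /linear_boundedP [M [Mr hM]].
suff [S hS] : exists S : H2 -> H1, forall x y, '[T x, y] = '[x, S y].
  by rewrite /adjoint; case: xgetP => [S' _ //|/(_ S)]; case.
suff h y : exists z, forall x, '[T x, y] = '[x, z].
  by have [S hS] := choice h; exists S.
pose M1 : R[i] := `|M| + 1.
have M1_ge0 : 0 <= M1 by rewrite addr_ge0.
have inn (V : hilbertType R) (v : V) : (complex.Re '[v, v])%:C = `|v| ^+ 2.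
  by rewrite RRe_real inner_norm// ger0_real// exprn_ge0.
have M1E : (complex.Re M1)%:C = M1 by rewrite RRe_real// ger0_real.
have {}hM x : `|T x| <= M1 * `|x|.
  by apply: hM; rewrite (le_lt_trans (real_ler_norm Mr))// ltrDl.
apply: (@riesz R H1 (fun x => '[T x, y]) (complex.Re M1 ^+ 2 * complex.Re '[y, y])).
- by rewrite mulr_ge0 ?sqr_ge0// -lecR inn exprn_ge0.
- by move=> a b; rewrite linearD linearDl.
- by move=> a b; rewrite linearZ linearZl_LR.
move=> x; have := CS_re (T x) y => /le_trans; apply.
rewrite mulrAC ler_wpM2r//; first by rewrite -lecR inn exprn_ge0.
rewrite -lecR rmorphM rmorphXn !inn [X in X ^+ 2 * _]M1E.
rewrite [X in _ * X](inn _ x) -exprMn.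
by rewrite ler_sqr ?nnegrE ?mulr_ge0.
Qed.

(* In R, sup set0 = inf set0 = 0, so numerical_radius, crawford and
   inf_norm_re_rot below are 0 on the zero space. *)
Section operators.
Variables (R : realType) (H : hilbertType R).
Implicit Type T : H -> H.

Definition opnorm T : R :=
  sup [set rnorm (T x) | x in [set x | `|x| <= 1]].

Definition re_op T : H -> H := fun x => 2^-1 *: (T x + adjoint T x).

Definition numerical_radius T : R :=
  sup [set rnorm '[T x, x] | x in [set x | `|x| = 1]].

Definition crawford T : R :=
  inf [set rnorm '[T x, x] | x in [set x | `|x| = 1]].

Definition inf_norm_re_rot T : R :=
  inf [set inf [set rnorm (re_op (fun y => expi t *: T y) x)
                  | x in [set x | `|x| = 1]]
      | t in [set: R]].

End operators.

Definition offdiag (R : realType) (H1 H2 : hilbertType R)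
    (X : H2 -> H1) (Y : H1 -> H2) : hsum H1 H2 -> hsum H1 H2 :=
  fun u => (X u.2, Y u.1).

(* Main.v *)
Require Import Defs.
From HB Require Import structures.
From mathcomp Require Import all_boot all_order all_algebra complex.
From mathcomp Require Import ring lra trigo.
From mathcomp Require Import boolp classical_sets functions reals topology.
From mathcomp Require Import normedtype.

Import Order.TTheory GRing.Theory Num.Theory.
Import numFieldNormedType.Exports.

Local Open Scope classical_set_scope.
Local Open Scope ring_scope.

(** Write w for the numerical radius of the off-diagonal operator, and S, m, c
    as in the theorem. For a unimodular a, put A = a X + a^* Y^*, an operator
    from H2 to H1. The real part of the quadratic form of the block operator
    at (v, u), multiplied by a, is Re <A u, v>; hence
    Re <A u, v> <= w (|u|^2 + |v|^2) ([offdiag_form_le]). Polarising, i.e.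
    replacing v by t v and looking at the discriminant in t, gives
    |A| <= 2 w ([offdiag_form_sqr]), and therefore |A^* A x| <= 4 w^2 |x|.

    With e = a^2 one computes A^* A = S + 2 R_e where R_e = Re (e Y X)
    ([rnorm_S_re_op]). For a unit vector x this yields
<<
      16 w^4 >= |(S + 2 R_e) x|^2
              = |S x|^2 + 4 |R_e x|^2 + 2 Re (e <(YXS + SYX) x, x>),
>>
    the last term because S is selfadjoint ([rnorm_S_re_op_expand]). The phase
    e is free: choosing it, for the given x, so that the last real part is the
    modulus of <(YXS + SYX) x, x> bounds the right-hand side below by
    |S x|^2 + 4 c^2 + 2 m. The supremum over x is the theorem. *)

(** * Inner products, real norms and phases *)

Section inner_product.
Local Open Scope complex_scope.
Context {R : realType} {H : hilbertType R}.
Implicit Types x y z : H.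

Lemma rnormE {V : normedZmodType R[i]} (v : V) : `|v| = (rnorm v)%:C.
Proof. by rewrite /rnorm RRe_real// ger0_real. Qed.

Lemma rnorm_ge0 {V : normedZmodType R[i]} (v : V) : 0 <= rnorm v.
Proof. by rewrite -lecR -rnormE; exact: normr_ge0. Qed.

Lemma rnormM (a b : R[i]) : rnorm (a * b) = rnorm a * rnorm b.
Proof. by apply: complexI; rewrite -rnormE normrM !rnormE -rmorphM. Qed.

Lemma rnormZ (a : R[i]) x : rnorm (a *: x) = rnorm a * rnorm x.
Proof. by apply: complexI; rewrite -rnormE normrZ !rnormE -rmorphM. Qed.

Lemma rnorm_real (r : R) : 0 <= r -> rnorm (r%:C : R[i]) = r.
Proof. by move=> r0; rewrite /rnorm ger0_norm ?lecR. Qed.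

Lemma rnorm_conj (a : R[i]) : rnorm (Num.conj a) = rnorm a.
Proof. by rewrite /rnorm norm_conjC. Qed.

Lemma rnorm_eq1 {V : normedZmodType R[i]} (v : V) : `|v| = 1 <-> rnorm v = 1.
Proof. by split=> [v1|v1]; [rewrite /rnorm v1|rewrite rnormE v1]. Qed.

Lemma Re_le_rnorm (c : R[i]) : complex.Re c <= rnorm c.
Proof.
rewrite -lecR -rnormE; apply: le_trans (normc_ge_Re c).
by rewrite lecR ler_norm.
Qed.

Lemma innerC x y : '[x, y] = Num.conj '[y, x].
Proof. by rewrite (hermC inner) expr0 mul1r. Qed.

Lemma innerDl x y z : '[x + y, z] = '[x, z] + '[y, z].
Proof. by rewrite linearDl. Qed.

Lemma innerDr x y z : '[x, y + z] = '[x, y] + '[x, z].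
Proof. by rewrite linearDr. Qed.

Lemma innerZl (a : R[i]) x y : '[a *: x, y] = a * '[x, y].
Proof. by rewrite linearZl_LR. Qed.

Lemma innerZr (a : R[i]) x y : '[x, a *: y] = Num.conj a * '[x, y].
Proof. by rewrite innerC innerZl rmorphM /= -innerC. Qed.

Lemma Re_conj (c : R[i]) : complex.Re (Num.conj c) = complex.Re c.
Proof. by case: c. Qed.

Lemma Re_innerC x y : complex.Re '[x, y] = complex.Re '[y, x].
Proof. by rewrite innerC Re_conj. Qed.

Lemma ReD (a b : R[i]) : complex.Re (a + b) = complex.Re a + complex.Re b.
Proof. exact: raddfD. Qed.

Lemma Re_conj_inner (a : R[i]) x y :
  complex.Re (Num.conj a * '[x, y]) = complex.Re (a * '[y, x]).
Proof. by rewrite -Re_conj rmorphM /= conjCK -innerC. Qed.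

Lemma Re_inner_self x : complex.Re '[x, x] = rnorm x ^+ 2.
Proof. by apply: complexI; rewrite rmorphXn /= -rnormE inner_norm rnormE -rmorphXn. Qed.

Lemma inner_inj x y : (forall z, '[z, x] = '[z, y]) -> x = y.
Proof.
move=> h; apply/eqP; rewrite -subr_eq0 -normr_eq0 -sqrf_eq0 -inner_norm.
by rewrite -scaleN1r innerDr innerZr h rmorphN rmorph1 mulN1r subrr.
Qed.

Lemma rnormD_sqr x y :
  rnorm (x + y) ^+ 2 = rnorm x ^+ 2 + rnorm y ^+ 2 + 2 * complex.Re '[y, x].
Proof.
rewrite -!Re_inner_self innerDl !innerDr !ReD (Re_innerC x y); ring.
Qed.

(** The cancellation behind the estimate of an operator norm by the form
    Re <A u, v>: it is tested at v = p = A u, where both sides carry a factor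
    |p|^2. *)
Lemma rnorm_sqr_le_of_form x (k : R) : 0 <= k ->
  complex.Re '[x, x] ^+ 2 <= k * rnorm x ^+ 2 -> rnorm x ^+ 2 <= k.
Proof.
move=> k0; rewrite Re_inner_self.
have := sqr_ge0 (rnorm x); set s := rnorm x ^+ 2 => s0.
have [->//|sn0] := eqVneq s 0.
by rewrite expr2 ler_pM2r// lt_neqAle eq_sym sn0.
Qed.

Lemma exists_phase (c : R[i]) : exists t, complex.Re (expi t * c) = rnorm c.
Proof.
have [->|c0] := eqVneq c 0.
  by exists 0; rewrite mulr0 /rnorm normr0.
case: c c0 => a b c0; rewrite /rnorm normc_def /=.
set r := Num.sqrt _.
have r2 : r ^+ 2 = a ^+ 2 + b ^+ 2 by rewrite sqr_sqrtr// addr_ge0 ?sqr_ge0.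
have r0 : 0 < r.
  rewrite lt_neqAle sqrtr_ge0 andbT eq_sym; apply/negP => /eqP r0.
  move: r2; rewrite r0 expr0n => /esym/eqP; rewrite paddr_eq0 ?sqr_ge0//.
  rewrite !sqrf_eq0 => /andP[/eqP a0 /eqP b0].
  by move: c0; rewrite a0 b0 eqxx.
have ar : -1 <= a / r <= 1.
  rewrite -ler_norml normrM normfV (gtr0_norm r0) ler_pdivrMr// mul1r.
  rewrite -ler_sqr ?nnegrE ?(ltW r0)// real_normK ?num_real// r2.
  by rewrite lerDl sqr_ge0.
have sE : sin (acos (a / r)) = `|b| / r.
  rewrite sin_acos//.
  have -> : 1 - (a / r) ^+ 2 = (b / r) ^+ 2.
    rewrite !exprMn exprVn; have := gt_eqF r0 => rn0.
    have -> : b ^+ 2 = r ^+ 2 - a ^+ 2 by rewrite r2; ring.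
    by field; rewrite rn0.
  by rewrite sqrtr_sqr normrM normfV (gtr0_norm r0).
(* With [s] the sign of [b], the phase is minus the argument of [a + i b]: its
   cosine is [a / r], its sine [- s |b| / r]. *)
have final (s : R) : s * b = `|b| ->  a / r * a + s * (`|b| / r) * b = r.
  move=> sb.
  have -> : a / r * a + s * (`|b| / r) * b = (a ^+ 2 + (s * b) * `|b|) / r.
    by ring.
  rewrite sb -expr2 real_normK ?num_real//.
  by rewrite -r2 expr2 mulfK ?gt_eqF.
have [b0|b0] := leP 0 b.
  exists (- acos (a / r)); rewrite /expi /= cosN sinN acosK// sE.
  by rewrite mulNr opprK -[`|b| / r]mul1r final// mul1r ger0_norm.
exists (acos (a / r)); rewrite /expi /= acosK// sE.
rewrite -mulNr -[in X in _ + X]mulN1r final// mulN1r ltr0_norm//.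
Qed.

Lemma rnorm_expi (t : R) : rnorm (expi t) = 1.
Proof. by rewrite /rnorm normc_def /= cos2Dsin2 sqrtr1. Qed.

Lemma expi_half (t : R) : expi (t / 2) ^+ 2 = expi t.
Proof.
have {2}-> : t = t / 2 + t / 2 by field.
by rewrite /expi cosD sinD expr2; simpc; congr (_ +i* _); ring.
Qed.

(** Multiplying [x] by a phase that makes <x, y> real and nonnegative reduces
    this to the Cauchy-Schwarz inequality for the real part. *)
Lemma rnorm_inner_le x y : rnorm '[x, y] <= rnorm x * rnorm y.
Proof.
have [t ht] := exists_phase '[x, y].
have h := CS_re (expi t *: x) y.
rewrite !Re_inner_self rnormZ rnorm_expi mul1r innerZl ht -exprMn in h.
by rewrite -ler_sqr ?nnegrE ?mulr_ge0 ?rnorm_ge0.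
Qed.
End inner_product.

(** * Adjoints and bounded operators *)

Section adjoint_theory.
Local Open Scope complex_scope.
Context {R : realType} {H1 H2 : hilbertType R}.

(** Identifies adjoints of composites and of multiples without recourse to
    their boundedness: any formal adjoint is the adjoint. *)
Lemma adjoint_unique (T : H1 -> H2) (T' : H2 -> H1) :
  (forall x y, '[T x, y] = '[x, T' y]) -> adjoint T = T'.
Proof.
move=> h; rewrite /adjoint; case: xgetP => [S _ hS|/(_ T')]; last by [].
by apply/funext => y; apply: inner_inj => x; rewrite -hS -h.
Qed.

Lemma adjointZ {T : {linear H1 -> H2}} (bT : bounded_near T (nbhs 0)) a y :
  adjoint T (a *: y) = a *: adjoint T y.
Proof.
by apply: inner_inj => x; rewrite innerZr -!(adjointP bT) innerZr.
Qed.

Lemma adjointD {T : {linear H1 -> H2}} (bT : bounded_near T (nbhs 0)) y z :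
  adjoint T (y + z) = adjoint T y + adjoint T z.
Proof.
by apply: inner_inj => x; rewrite innerDr -!(adjointP bT) innerDr.
Qed.

Lemma adjoint_inner {T : {linear H1 -> H2}} (bT : bounded_near T (nbhs 0)) x y :
  '[adjoint T y, x] = '[y, T x].
Proof. by rewrite innerC -(adjointP bT) -innerC. Qed.

Lemma rnorm_bounded (T : {linear H1 -> H2}) :
  bounded_near T (nbhs 0) ->
  exists2 M : R, 0 <= M & forall x, rnorm (T x) <= M * rnorm x.
Proof.
move=> /linear_boundedP [M [Mr hM]].
exists (rnorm (`|M| + 1)) => [|x]; first exact: rnorm_ge0.
rewrite -lecR rmorphM /= -!rnormE ger0_norm ?addr_ge0//.
by apply: hM; rewrite (le_lt_trans (real_ler_norm Mr))// ltrDl.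
Qed.
End adjoint_theory.

(** * Suprema and infima over the unit sphere *)

Section extrema.
Local Open Scope complex_scope.
Context {R : realType} {H : hilbertType R}.
Implicit Types (x : H) (T : H -> H).

(** Homogeneity carries the bound from the unit sphere to the whole space; the
    operator bound [M] makes the supremum a genuine one. *)
Lemma numerical_radius_ub T (M : R) :
  (forall a x, T (a *: x) = a *: T x) ->
  (forall x, rnorm (T x) <= M * rnorm x) ->
  forall x, rnorm '[T x, x] <= numerical_radius T * rnorm x ^+ 2.
Proof.
move=> TZ TM x; have [x0|x0] := eqVneq (rnorm x) 0.
  by rewrite x0 expr0n mulr0 (le_trans (rnorm_inner_le _ _))// x0 mulr0.
have xp : 0 < rnorm x by rewrite lt_neqAle eq_sym x0 rnorm_ge0.
have unit_ub y : rnorm y = 1 -> rnorm '[T y, y] <= numerical_radius T.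
  move=> y1; apply: ub_le_sup; last by exists y => //; exact/rnorm_eq1.
  exists M => _ [z /rnorm_eq1 z1 <-].
  by rewrite (le_trans (rnorm_inner_le _ _))// z1 mulr1 -[M]mulr1 -z1.
have rV : rnorm ((rnorm x)^-1%:C : R[i]) = (rnorm x)^-1.
  by rewrite rnorm_real ?invr_ge0 ?rnorm_ge0.
have := unit_ub ((rnorm x)^-1%:C *: x); rewrite rnormZ rV mulVf// => /(_ erefl).
rewrite TZ innerZl innerZr !rnormM rnorm_conj rV.
by rewrite mulrA -expr2 exprVn mulrC ler_pdivrMr// exprn_gt0.
Qed.

Lemma crawford_le T x : rnorm x = 1 -> crawford T <= rnorm '[T x, x].
Proof.
move=> x1; apply: ge_inf; last by exists x => //; exact/rnorm_eq1.
by exists 0 => _ [y _ <-]; exact: rnorm_ge0.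
Qed.

Lemma inf_ge0 (A : set R) : (forall a, A a -> 0 <= a) -> 0 <= inf A.
Proof.
move=> A0; have [->|/set0P An0] := eqVneq A set0; first by rewrite inf0.
exact: lb_le_inf.
Qed.

Lemma crawford_ge0 T : 0 <= crawford T.
Proof. by apply: inf_ge0 => _ [x _ <-]; exact: rnorm_ge0. Qed.

Lemma inf_norm_re_rot_ge0 T : 0 <= inf_norm_re_rot T.
Proof.
apply: inf_ge0 => _ [t _ <-]; apply: inf_ge0 => _ [x _ <-]; exact: rnorm_ge0.
Qed.

Lemma inf_norm_re_rot_le T t x : rnorm x = 1 ->
  inf_norm_re_rot T <= rnorm (re_op (fun y => expi t *: T y) x).
Proof.
move=> x1.
apply: (@le_trans _ _ (inf [set rnorm (re_op (fun y => expi t *: T y) x)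
                              | x in [set x | `|x| = 1]])).
  apply: ge_inf; last by exists t.
  exists 0 => _ [s _ <-]; apply: inf_ge0 => _ [y _ <-]; exact: rnorm_ge0.
apply: ge_inf; last by exists x => //; exact/rnorm_eq1.
by exists 0 => _ [y _ <-]; exact: rnorm_ge0.
Qed.

Lemma numerical_radius_ge0 T : 0 <= numerical_radius T.
Proof.
rewrite /numerical_radius; set A := (X in sup X).
have [[[r Ar] ubA]|/sup_out ->//] := pselect (has_sup A).
apply: le_trans (ub_le_sup ubA Ar); case: Ar => x _ <-; exact: rnorm_ge0.
Qed.

(** The supremum defining [opnorm] is over the unit ball, so homogeneity passes
    from the sphere to the ball. At the vector
    0 the bound reduces to [0 <= K]. *)
Lemma opnorm_sqr_le T (K : R) : 0 <= K ->
  (forall a x, T (a *: x) = a *: T x) ->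
  (forall x, rnorm x = 1 -> rnorm (T x) ^+ 2 <= K) ->
  opnorm T ^+ 2 <= K.
Proof.
move=> K0 TZ TK.
suff ub x : `|x| <= 1 -> rnorm (T x) <= Num.sqrt K.
  have T0 : 0 <= opnorm T.
    apply: le_trans (rnorm_ge0 (T 0)) _; apply: ub_le_sup.
      by exists (Num.sqrt K) => _ [y y1 <-]; exact: ub.
    by exists 0 => //=; rewrite normr0.
  have : opnorm T <= Num.sqrt K.
    apply: ge_sup; last by move=> _ [y y1 <-]; exact: ub.
    by exists (rnorm (T 0)), 0 => //=; rewrite normr0.
  by rewrite -ler_sqr ?nnegrE ?sqrtr_ge0// sqr_sqrtr.
rewrite rnormE -[1]/(1%:C) lecR => x1.
rewrite -ler_sqr ?nnegrE ?rnorm_ge0 ?sqrtr_ge0// sqr_sqrtr//.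
have [x0|x0] := eqVneq x 0.
  by rewrite x0 -(scale0r (0 : H)) TZ scale0r /rnorm normr0 expr0n.
have xn0 : rnorm x != 0.
  by apply: contra_neq x0 => x0; apply/eqP; rewrite -normr_eq0 rnormE x0.
have -> : x = (rnorm x)%:C *: ((rnorm x)^-1%:C *: x).
  by rewrite scalerA -rmorphM mulfV// rmorph1 scale1r.
rewrite TZ rnormZ rnorm_real ?rnorm_ge0// exprMn.
have := TK ((rnorm x)^-1%:C *: x).
rewrite rnormZ rnorm_real ?invr_ge0 ?rnorm_ge0// mulVf// => /(_ erefl).
by apply: le_trans; rewrite ler_piMl ?sqr_ge0// exprn_ile1 ?rnorm_ge0.
Qed.
End extrema.

(** * The off-diagonal operator *)

Section offdiagonal.
Local Open Scope complex_scope.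
Context {R : realType} {H1 H2 : hilbertType R}.
Variables (X : {linear H2 -> H1}) (Y : {linear H1 -> H2}).
Hypotheses (bX : bounded_near X (nbhs 0)) (bY : bounded_near Y (nbhs 0)).
Local Notation w := (numerical_radius (offdiag X Y)).
Local Notation X' := (adjoint X).
Local Notation Y' := (adjoint Y).
Implicit Types (x u : H2) (v : H1).

Lemma rnorm_hsum (z : hsum H1 H2) :
  rnorm z ^+ 2 = rnorm z.1 ^+ 2 + rnorm z.2 ^+ 2.
Proof.
rewrite -!Re_inner_self /= -[in LHS]/(hsum_inner z z) /hsum_inner.
by case: '[z.1, z.1] => ??; case: '[z.2, z.2] => ??.
Qed.

Lemma offdiag_bounded : exists M : R,
  forall z, rnorm (offdiag X Y z) <= M * rnorm z.
Proof.
have [M M0 hM] := rnorm_bounded X bX; have [N N0 hN] := rnorm_bounded Y bY.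
exists (M + N) => z.
rewrite -ler_sqr ?nnegrE ?mulr_ge0 ?rnorm_ge0 ?addr_ge0// exprMn !rnorm_hsum /=.
have h1 : rnorm (X z.2) ^+ 2 <= M ^+ 2 * rnorm z.2 ^+ 2.
  by rewrite -exprMn ler_sqr ?nnegrE ?mulr_ge0 ?rnorm_ge0.
have h2 : rnorm (Y z.1) ^+ 2 <= N ^+ 2 * rnorm z.1 ^+ 2.
  by rewrite -exprMn ler_sqr ?nnegrE ?mulr_ge0 ?rnorm_ge0.
have a0 := sqr_ge0 (rnorm z.1); have b0 := sqr_ge0 (rnorm z.2).
have MN := mulr_ge0 M0 N0.
move: h1 h2 a0 b0; set a := rnorm z.1 ^+ 2; set b := rnorm z.2 ^+ 2.
have -> : (M + N) ^+ 2 * (a + b) = M ^+ 2 * b + N ^+ 2 * a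
   + (M ^+ 2 * a + N ^+ 2 * b + (M * N) * (a + b) *+ 2) by ring.
move=> h1 h2 a0 b0; rewrite (le_trans (lerD h1 h2))// lerDl.
by rewrite !addr_ge0 ?mulrn_wge0 ?(mulr_ge0 MN, mulr_ge0 (sqr_ge0 _)) ?addr_ge0.
Qed.

(** The left side is the real part of [a] times the quadratic form of the block
    operator at [(v, u)], since Re (a^* <Y^* u, v>) = Re (a <Y v, u>). *)
Lemma offdiag_form_le (a : R[i]) u v : rnorm a = 1 ->
  complex.Re '[a *: X u + Num.conj a *: Y' u, v]
    <= w * rnorm v ^+ 2 + w * rnorm u ^+ 2.
Proof.
move=> a1; have [M hM] := offdiag_bounded.
have TZ (b : R[i]) z : offdiag X Y (b *: z) = b *: offdiag X Y z.
  by rewrite /offdiag /= !linearZ.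
have := numerical_radius_ub (offdiag X Y) M TZ hM ((v, u) : hsum H1 H2).
rewrite rnorm_hsum /= -mulrDr; apply: le_trans.
rewrite -[leRHS]mul1r -a1 -rnormM.
apply: le_trans (Re_le_rnorm _).
rewrite -[X in _ * X]/('[X u, v] + '[Y v, u]) mulrDr innerDl !innerZl.
rewrite !ReD lerD//.
by rewrite Re_conj_inner -(adjointP bY).
Qed.

(** Polarisation: replacing [v] by [t v] in [offdiag_form_le] gives a
    nonnegative quadratic polynomial in [t], whose discriminant is then
    nonpositive. This is the bound 2 w on the norm of a X + a^* Y^*, in a form
    symmetric in the two arguments and thus usable for the adjoint too. *)
Lemma offdiag_form_sqr (a : R[i]) u v : rnorm a = 1 ->
  complex.Re '[a *: X u + Num.conj a *: Y' u, v] ^+ 2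
    <= 4 * w ^+ 2 * (rnorm u ^+ 2 * rnorm v ^+ 2).
Proof.
move=> a1.
have w0 : 0 <= w by exact: numerical_radius_ge0.
set c := complex.Re _.
have : (- c / 2) ^+ 2 <= (w * rnorm u ^+ 2) * (w * rnorm v ^+ 2).
  apply: discr => [|t]; first by rewrite mulr_ge0 ?sqr_ge0.
  have := offdiag_form_le a u (t%:C *: v) a1.
  rewrite innerZr rnormZ exprMn.
  have -> : rnorm (t%:C : R[i]) ^+ 2 = t ^+ 2.
    by rewrite /rnorm normc_def /= expr0n addr0 sqrtr_sqr real_normK ?num_real.
  have -> : complex.Re (Num.conj (t%:C : R[i]) *
      '[a *: X u + Num.conj a *: Y' u, v]) = t * c.
    by rewrite /c; case: '[_, _] => b d /=; rewrite oppr0 mul0r subr0.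
  lra.
lra.
Qed.

Local Notation S := ((X' \o X) \+ (Y \o Y')).
Local Notation rot t := (fun y => expi t *: (Y \o X) y).

Lemma absqr_sumZ (a : R[i]) x : S (a *: x) = a *: S x.
Proof. by rewrite /= !linearZ /= !(adjointZ bX, adjointZ bY) linearZ scalerDr. Qed.

Lemma absqr_sum_selfadjoint x u : '[S x, u] = '[x, S u].
Proof.
rewrite /= innerDl innerDr -(adjointP bX) -(adjoint_inner bY).
by rewrite (adjoint_inner bX) (adjointP bY).
Qed.

Lemma re_op_rot t x :
  re_op (rot t) x
  = 2^-1 *: (expi t *: Y (X x) + Num.conj (expi t) *: X' (Y' x)).
Proof.
rewrite /re_op (@adjoint_unique _ _ _ _ (fun y => Num.conj (expi t) *: X' (Y' y)))//.
by move=> y z; rewrite innerZl innerZr /= conjCK (adjointP bY) (adjointP bX).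
Qed.

(** The operator on the left is A^* A for A = a X + a^* Y^* with a^2 = exp(it),
    whence the half angle; each factor has norm at most 2 w. *)
Lemma rnorm_S_re_op t x :
  rnorm (S x + 2 *: re_op (rot t) x) ^+ 2
    <= 16 * w ^+ 4 * rnorm x ^+ 2.
Proof.
set a := expi (t / 2); have a1 : rnorm a = 1 by exact: rnorm_expi.
pose A u := a *: X u + Num.conj a *: Y' u.
pose A' v := Num.conj a *: X' v + a *: Y v.
have AP u v : '[A u, v] = '[u, A' v].
  rewrite /A /A' innerDl innerDr !innerZl !innerZr conjCK (adjointP bX).
  by rewrite (adjoint_inner bY).
have aa : a * Num.conj a = 1 by rewrite -normCK rnormE a1 expr1n.
have -> : S x + 2 *: re_op (rot t) x = A' (A x).
  rewrite re_op_rot scalerA mulfV ?pnatr_eq0// scale1r.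
  rewrite /A' /A (adjointD bX) !(adjointZ bX).
  rewrite [Y (_ + _)]linearD ![Y (_ *: _)]linearZ !scalerDr /= !scalerA.
  rewrite aa [Num.conj a * a]mulrC aa !scale1r -!expr2 -rmorphXn /= expi_half.
  by rewrite [_ *: Y _ + Y _]addrC [RHS]addrACA [in RHS](addrC _ (_ *: Y _)).
have w0 : 0 <= w by exact: numerical_radius_ge0.
set p := A x; set y := A' p.
have hp : rnorm p ^+ 2 <= 4 * w ^+ 2 * rnorm x ^+ 2.
  apply: rnorm_sqr_le_of_form; first by rewrite !mulr_ge0 ?rnorm_ge0.
  rewrite -mulrA; exact: offdiag_form_sqr.
have hy : rnorm y ^+ 2 <= 4 * w ^+ 2 * rnorm p ^+ 2.
  apply: rnorm_sqr_le_of_form; first by rewrite !mulr_ge0 ?rnorm_ge0.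
  rewrite {2}/y -AP -mulrA [rnorm p ^+ 2 * _]mulrC.
  exact: offdiag_form_sqr.
apply: (le_trans hy).
have -> : 16 * w ^+ 4 * rnorm x ^+ 2
  = 4 * w ^+ 2 * (4 * w ^+ 2 * rnorm x ^+ 2) by ring.
by rewrite ler_wpM2l// mulr_ge0 ?sqr_ge0.
Qed.

(** In the cross term, selfadjointness of S moves it from one side of the inner
    product to the other, turning <YX x, S x> into <SYX x, x> and, after
    conjugation, <(YX)^* x, S x> into <YXS x, x>. *)
Lemma rnorm_S_re_op_expand t x :
  rnorm (S x + 2 *: re_op (rot t) x) ^+ 2
  = rnorm (S x) ^+ 2 + 4 * rnorm (re_op (rot t) x) ^+ 2
    + 2 * complex.Re (expi t * '[((Y \o X \o S) \+ (S \o Y \o X)) x, x]).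
Proof.
rewrite rnormD_sqr rnormZ exprMn.
have -> : rnorm (2 : R[i]) = 2 by rewrite /rnorm ger0_norm.
congr (_ + _ + _); first by congr (_ * _); ring.
congr (_ * _); rewrite re_op_rot scalerA mulfV ?pnatr_eq0// scale1r.
rewrite innerDl !innerZl -absqr_sum_selfadjoint.
have -> : '[((Y \o X \o S) \+ (S \o Y \o X)) x, x] = '[Y (X (S x)), x] + '[S (Y (X x)), x].
  by rewrite -innerDl.
rewrite mulrDr !ReD addrC; congr (_ + _).
by rewrite Re_conj_inner -(adjointP bX) -(adjointP bY).
Qed.

End offdiagonal.

Theorem theorem2p10 (R : realType) (H1 H2 : hilbertType R)
    (X : {linear H2 -> H1}) (Y : {linear H1 -> H2})
    (bX : bounded_near X (nbhs 0)) (bY : bounded_near Y (nbhs 0)) :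
  let S : H2 -> H2 := (adjoint X \o X) \+ (Y \o adjoint Y) in
  numerical_radius (offdiag X Y) ^+ 4 >=
    1 / 16 * opnorm S ^+ 2 + 1 / 4 * inf_norm_re_rot (Y \o X) ^+ 2
    + 1 / 8 * crawford ((Y \o X \o S) \+ (S \o Y \o X)).
Proof.
cbv zeta; set S : H2 -> H2 := (adjoint X \o X) \+ (Y \o adjoint Y).
set w := numerical_radius _; set c := inf_norm_re_rot _; set m := crawford _.
have bound x : rnorm x = 1 ->
    rnorm (S x) ^+ 2 + 4 * c ^+ 2 + 2 * m <= 16 * w ^+ 4.
  move=> x1.
  (* The phase depends on [x]; [c] is an infimum over all phases, so any will do. *)
  have [t ht] := exists_phase '[((Y \o X \o S) \+ (S \o Y \o X)) x, x].
  have hm := crawford_le ((Y \o X \o S) \+ (S \o Y \o X)) x x1.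
  have hc := inf_norm_re_rot_le (Y \o X) t x x1.
  have := rnorm_S_re_op X Y bX bY t x.
  rewrite (rnorm_S_re_op_expand X Y bX bY) ht x1 expr1n mulr1.
  apply: le_trans; apply: lerD; last by rewrite ler_pM2l.
  rewrite lerD2l ler_pM2l// ler_sqr ?nnegrE ?rnorm_ge0//.
  exact: inf_norm_re_rot_ge0.
have [c0 m0] : 0 <= c /\ 0 <= m.
  by split; [exact: inf_norm_re_rot_ge0|exact: crawford_ge0].
have [[x x1]|no_unit] := pselect (exists x : H2, rnorm x = 1).
  have : opnorm S ^+ 2 <= 16 * w ^+ 4 - 4 * c ^+ 2 - 2 * m.
    apply: opnorm_sqr_le => [|a z|z /bound]; last by lra.
    - have := bound x x1; have := sqr_ge0 (rnorm (S x)); lra.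
    - exact: absqr_sumZ.
  lra.
(* Here [H2 = 0]: the unit sphere is empty and an infimum over it is 0. *)
have empty : [set z : H2 | `|z| = 1] = set0.
  rewrite -subset0 => z z1; apply: no_unit; exists z; exact/rnorm_eq1.
have -> : m = 0 by rewrite /m /crawford empty image_set0 inf0.
have -> : c = 0.
  apply/eqP; rewrite eq_le c0 andbT /c /inf_norm_re_rot empty.
  apply: ge_inf; last by exists 0 => //; rewrite image_set0 inf0.
  by exists 0 => _ [t _ <-]; rewrite image_set0 inf0.
have : opnorm S ^+ 2 <= 0.
  apply: opnorm_sqr_le => // [|z z1]; first exact: absqr_sumZ.
  by case: no_unit; exists z.
have : 0 <= w ^+ 4 by rewrite exprn_even_ge0.
rewrite expr0n /=; lra.
Qed.
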